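(* Let $\mathbb{V}_1$, $\mathbb{V}_2$, $\mathbb{V}_3$ be the subvarieties of $\mathbb{PBZL}^{\ast}$ axiomatised relative to $\mathbb{PBZL}^{\ast}$ by, respectively, the identities J2 and WSDM; J2 and SDM; J2, WSDM and SK. Then, with joins taken in the lattice of subvarieties of $\mathbb{PBZL}^{\ast}$: (i) $\mathbb{V}_1=\mathbb{OML}\vee V(\mathbb{AOL})$. (ii) $\mathbb{V}_2=\mathbb{OML}\vee\mathbb{SAOL}$. (iii) $\mathbb{V}_3=\mathbb{OML}\vee V(\mathbf{D}_3)$.
   Context: A bounded involution lattice is an algebra $(L,\wedge,\vee,{}^{\prime},0,1)$ such that $(L,\wedge,\vee,0,1)$ is a bounded lattice, $a^{\prime\prime}=a$, and $a\leq b$ implies $b^{\prime}\leq a^{\prime}$. It is a pseudo-Kleene algebra if $a\wedge a^{\prime}\leq b\vee b^{\prime}$ for all $a,b$. A BZ-lattice is an algebra $\mathbf{L}=(L,\wedge,\vee,{}^{\prime},{}^{\sim},0,1)$ whose reduct without ${}^{\sim}$ is a pseudo-Kleene algebra and such that for all $a,b\in L$: $a\wedge a^{\sim}=0$; $a\leq a^{\sim\sim}$; $a\leq b$ implies $b^{\sim}\leq a^{\sim}$; $a^{\sim\prime}=a^{\sim\sim}$. Write $\Diamond x=x^{\sim\sim}$ and $\square x=x^{\prime\sim}$. A PBZ$^{\ast}$-lattice is a BZ-lattice satisfying $(a\wedge a^{\prime})^{\sim}\leq a^{\sim}\vee\square a$ for all $a$, and which is paraorthomodular: $a\leq b$ and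 $a^{\prime}\wedge b=0$ imply $a=b$. PBZ$^{\ast}$-lattices form a variety $\mathbb{PBZL}^{\ast}$. Identities: SDM: $(x\wedge y)^{\sim}\approx x^{\sim}\vee y^{\sim}$. WSDM: $(x\wedge y^{\sim})^{\sim}\approx x^{\sim}\vee\Diamond y$. J2: $x\approx(x\wedge(y\wedge y^{\prime})^{\sim})\vee(x\wedge\Diamond(y\wedge y^{\prime}))$. SK: $x\wedge\Diamond y\leq\square x\vee y$. $\mathbb{OML}$ is the variety of orthomodular lattices, viewed as PBZ$^{\ast}$-lattices with $x^{\sim}=x^{\prime}$ (i.e. the PBZ$^{\ast}$-lattices satisfying $x^{\sim}\approx x^{\prime}$). An antiortholattice is a PBZ$^{\ast}$-lattice $\mathbf{L}$ with $\{a\in L: a\wedge a^{\prime}=0\}=\{0,1\}$; $\mathbb{AOL}$ is the class of antiortholattices, and $V(\mathbb{K})$ (or $V(\mathbf{A})$) is the variety generated by $\mathbb{K}$ (or $\mathbf{A}$). $\mathbb{SAOL}$ is the subvariety of $V(\mathbb{AOL})$ axiomatised relative to $V(\mathbb{AOL})$ by SDM. $\mathbf{D}_3$ is the three-element chain $0<d_1<1$ with the order-reversing involution ${}^{\prime}$ (so $d_1^{\prime}=d_1$) and $0^{\sim}=1$, $d_1^{\sim}=1^{\sim}=0$. *)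

(* Defs.v *)
From mathcomp Require Import ssreflect ssrfun ssrbool.

Set Implicit Arguments.
Unset Strict Implicit.
Unset Printing Implicit Defensive.

Declare Scope bz_scope.
Delimit Scope bz_scope with BZ.
Local Open Scope bz_scope.

(* Varieties quantify over arbitrary families of algebras, so algebras are
   bundled and carry no axioms; the laws below are predicates on them. *)
Record algebra : Type := Algebra {
  carrier :> Type;
  meet : carrier -> carrier -> carrier;
  join : carrier -> carrier -> carrier;
  kneg : carrier -> carrier;   (* x |-> x' *)
  bneg : carrier -> carrier;   (* x |-> x~ *)
  bot : carrier;
  top : carrier
}.

Arguments bot {a}.
Arguments top {a}.

Reserved Notation "x `&` y" (at level 48, left associativity).
Reserved Notation "x `|` y" (at level 52, left associativity).
Notation "x `&` y" := (meet x y) : bz_scope.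
Notation "x `|` y" := (join x y) : bz_scope.
Notation "0" := bot : bz_scope.
Notation "1" := top : bz_scope.

Definition le (A : algebra) (x y : A) : Prop := x `&` y = x.
Notation "x <= y" := (le x y) : bz_scope.

Definition dia (A : algebra) (x : A) : A := bneg (bneg x).
Definition box (A : algebra) (x : A) : A := bneg (kneg x).

Definition class := algebra -> Prop.

Definition subclass (K K' : class) : Prop := forall A, K A -> K' A.

Definition class_eq (K K' : class) : Prop := forall A, K A <-> K' A.

Definition class_union (K K' : class) : class := fun A => K A \/ K' A.

Definition singleton_class (A : algebra) : class := fun B => B = A.

Record hom (A B : algebra) (f : A -> B) : Prop := Hom {
  hom_meet : {morph f : x y / x `&` y >-> x `&` y};
  hom_join : {morph f : x y / x `|` y >-> x `|` y};
  hom_kneg : {morph f : x / kneg x >-> kneg x};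
  hom_bneg : {morph f : x / bneg x >-> bneg x};
  hom_bot : f 0 = 0;
  hom_top : f 1 = 1
}.

Definition product (I : Type) (A : I -> algebra) : algebra := {|
  carrier := forall i, A i;
  meet := fun x y i => x i `&` y i;
  join := fun x y i => x i `|` y i;
  kneg := fun x i => kneg (x i);
  bneg := fun x i => bneg (x i);
  bot := fun i => 0;
  top := fun i => 1
|}.

(* Subalgebras are taken up to isomorphism, as embedded algebras.  The empty
   product is included, so a variety always contains a trivial algebra. *)
Record variety (V : class) : Prop := Variety {
  variety_H : forall (A B : algebra) (f : A -> B),
    hom f -> (forall y, exists x, f x = y) -> V A -> V B;
  variety_S : forall (A B : algebra) (f : B -> A),
    hom f -> injective f -> V A -> V B;
  variety_P : forall (I : Type) (A : I -> algebra),
    (forall i, V (A i)) -> V (product A)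
}.

Definition generated_variety (K : class) : class :=
  fun A => forall V, variety V -> subclass K V -> V A.

Record bounded_lattice (A : algebra) : Prop := BoundedLattice {
  bl_meetA : associative (@meet A);
  bl_joinA : associative (@join A);
  bl_meetC : commutative (@meet A);
  bl_joinC : commutative (@join A);
  bl_meetK : forall x y : A, x `&` (x `|` y) = x;
  bl_joinK : forall x y : A, x `|` (x `&` y) = x;
  bl_bot : forall x : A, 0 <= x;
  bl_top : forall x : A, x <= 1
}.

Record bounded_involution_lattice (A : algebra) : Prop :=
  BoundedInvolutionLattice {
  bi_lattice : bounded_lattice A;
  bi_knegK : involutive (@kneg A);
  bi_kneg_anti : forall x y : A, x <= y -> kneg y <= kneg x
}.

Record pseudo_kleene (A : algebra) : Prop := PseudoKleene {
  pk_involution : bounded_involution_lattice A;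
  pk_kleene : forall x y : A, x `&` kneg x <= y `|` kneg y
}.

Record BZ_lattice (A : algebra) : Prop := BZLattice {
  bz_pseudo_kleene : pseudo_kleene A;
  bz_meet_bneg : forall x : A, x `&` bneg x = 0;
  bz_le_dia : forall x : A, x <= bneg (bneg x);
  bz_bneg_anti : forall x y : A, x <= y -> bneg y <= bneg x;
  bz_kneg_bneg : forall x : A, kneg (bneg x) = bneg (bneg x)
}.

Definition paraorthomodular (A : algebra) : Prop :=
  forall x y : A, x <= y -> kneg x `&` y = 0 -> x = y.

Record PBZL (A : algebra) : Prop := PBZLattice {
  pbz_bz : BZ_lattice A;
  pbz_star : forall x : A, bneg (x `&` kneg x) <= bneg x `|` box x;
  pbz_paraorthomodular : paraorthomodular A
}.

Definition SDM (A : algebra) : Prop :=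
  forall x y : A, bneg (x `&` y) = bneg x `|` bneg y.

Definition WSDM (A : algebra) : Prop :=
  forall x y : A, bneg (x `&` bneg y) = bneg x `|` dia y.

Definition J2 (A : algebra) : Prop :=
  forall x y : A,
    x = (x `&` bneg (y `&` kneg y)) `|` (x `&` dia (y `&` kneg y)).

Definition SK (A : algebra) : Prop :=
  forall x y : A, x `&` dia y <= box x `|` y.

Definition subvariety (V : class) : Prop := variety V /\ subclass V PBZL.

(* The least subvariety of PBZL* above both arguments, as the intersection of
   all of them. *)
Definition subvariety_join (U V : class) : class :=
  fun A => forall W, subvariety W -> subclass (class_union U V) W -> W A.

Definition OML : class := fun A => PBZL A /\ forall x : A, bneg x = kneg x.

Definition antiortholattice (A : algebra) : Prop :=
  PBZL A /\ forall x : A, x `&` kneg x = 0 <-> x = 0 \/ x = 1.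

Definition AOL : class := antiortholattice.

Definition SAOL : class := fun A => generated_variety AOL A /\ SDM A.

Inductive chain3 : Set := c0 | cd | c1.

Definition D3 : algebra := {|
  carrier := chain3;
  meet := fun x y => match x, y with
    | c0, _ | _, c0 => c0
    | c1, z | z, c1 => z
    | cd, cd => cd
    end;
  join := fun x y => match x, y with
    | c1, _ | _, c1 => c1
    | c0, z | z, c0 => z
    | cd, cd => cd
    end;
  kneg := fun x => match x with c0 => c1 | cd => cd | c1 => c0 end;
  bneg := fun x => match x with c0 => c1 | cd | c1 => c0 end;
  bot := c0;
  top := c1
|}.

Definition V1 : class := fun A => [/\ PBZL A, J2 A & WSDM A].
Definition V2 : class := fun A => [/\ PBZL A, J2 A & SDM A].
Definition V3 : class := fun A => [/\ PBZL A, J2 A, WSDM A & SK A].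

(* Main.v *)
(* J2 says that e = (y /\ y')~ satisfies x = (x /\ e) \/ (x /\ e'), and with
   WSDM this makes x |-> x /\ e and x |-> x /\ e' complementary factor
   congruences.  In a subdirectly irreducible algebra e is therefore 0 or 1 for
   every y.  If e = 1 for all y, then y /\ y' = 0 for all y and the algebra is
   orthomodular.  If e = 0 for some y, put w = y /\ y' and let s be sharp:
   w /\ s lies below its own negation, and WSDM gives (w /\ s)~ = s~, so s is
   0 or 1 and the algebra is an antiortholattice.  An antiortholattice with SK
   has at most one element besides 0 and 1.  For the upper bounds, PBZ*-lattices
   form a variety because, in the presence of the star axiom, paraorthomodularity
   amounts to the orthomodular law for the elements x~~. *)
Require Import Defs.
From Stdlib Require List.
From mathcomp Require Import ssreflect ssrfun ssrbool boolp classical_sets.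

Set Implicit Arguments.
Unset Strict Implicit.
Unset Printing Implicit Defensive.

Local Open Scope bz_scope.

(** * Equational classes *)

Inductive term : Type :=
| Var of nat
| Meet of term & term
| Join of term & term
| Kneg of term
| Bneg of term
| Bot
| Top.

Fixpoint eval (A : algebra) (v : nat -> A) (t : term) : A :=
  match t with
  | Var n => v n
  | Meet s t => eval v s `&` eval v t
  | Join s t => eval v s `|` eval v t
  | Kneg t => kneg (eval v t)
  | Bneg t => bneg (eval v t)
  | Bot => 0
  | Top => 1
  end.

Lemma eval_hom (A B : algebra) (f : A -> B) (v : nat -> A) (t : term) :
  hom f -> f (eval v t) = eval (f \o v) t.
Proof.
move=> hf; elim: t => //= [s <- t <-|s <- t <-|t <-|t <-||].
- exact: hom_meet hf _ _.
- exact: hom_join hf _ _.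
- exact: hom_kneg hf _.
- exact: hom_bneg hf _.
- exact: hom_bot hf.
- exact: hom_top hf.
Qed.

Lemma proj_hom (I : Type) (A : I -> algebra) (i : I) :
  hom (fun x : product A => x i).
Proof. by split. Qed.

(** The quantifier over [v] stands outside the conjunction, so one valuation yields all the
    equations of a concrete list at once. *)
Definition models (E : list (term * term)) : class :=
  fun A => forall v : nat -> A,
    List.fold_right (fun e P => eval v e.1 = eval v e.2 /\ P) True E.

Lemma modelsP (E : list (term * term)) (A : algebra) :
  models E A <->
  forall e, List.In e E -> forall v : nat -> A, eval v e.1 = eval v e.2.
Proof.
rewrite /models; elim: E => [|e E IH] //=; split.
- move=> H e' [<-|inE] v; first by have [] := H v.
  by apply: (iffLR IH) => // w; have [] := H w.
- move=> H v; split; first by apply: H; left.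
  by move: v; apply/IH => e' inE v; apply: H; right.
Qed.

Lemma variety_models (E : list (term * term)) : variety (models E).
Proof.
split.
- move=> A B f hf surj /modelsP HA; apply/modelsP => e inE v.
  have [w fw] := choice (fun n => surj (v n)).
  have -> : v = f \o w by apply: funext => n /=.
  by rewrite -!eval_hom // HA.
- move=> A B f hf inj /modelsP HA; apply/modelsP => e inE v.
  by apply: inj; rewrite !eval_hom // HA.
- move=> I A HA; apply/modelsP => e inE v.
  apply: functional_extensionality_dep => i.
  rewrite !(eval_hom _ _ (proj_hom _ i)).
  exact: (iffLR (modelsP _ _) (HA i)).
Qed.

Lemma variety_ext (V W : class) : class_eq V W -> variety V -> variety W.
Proof.
move=> VW [vH vS vP]; split.
- by move=> A B f hf surj /VW VA; apply/VW; apply: (vH _ _ f).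
- by move=> A B f hf inj /VW VA; apply/VW; apply: (vS _ _ f).
- by move=> I A WA; apply/VW; apply: vP => i; apply/VW.
Qed.

Lemma variety_and (V W : class) :
  variety V -> variety W -> variety (fun A => V A /\ W A).
Proof.
move=> [vH vS vP] [wH wS wP]; split.
- by move=> A B f hf surj [VA WA]; split; [apply: (vH _ _ f)|apply: (wH _ _ f)].
- by move=> A B f hf inj [VA WA]; split; [apply: (vS _ _ f)|apply: (wS _ _ f)].
- by move=> I A VWA; split; [apply: vP|apply: wP] => i; have [] := VWA i.
Qed.

Lemma sub_generated (K : class) : subclass K (generated_variety K).
Proof. by move=> A KA V _; apply. Qed.

Definition assign (T : Type) (x y z : T) (n : nat) : T :=
  match n with O => x | S O => y | _ => z end.

Local Notation "'x" := (Var O).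
Local Notation "'y" := (Var (S O)).
Local Notation "'z" := (Var (S (S O))).
Local Notation Dia t := (Bneg (Bneg t)).
Local Notation Le s t := (Meet s t, s).

Lemma variety_J2 : variety J2.
Proof.
pose E := ('x, Join (Meet 'x (Bneg (Meet 'y (Kneg 'y))))
                    (Meet 'x (Dia (Meet 'y (Kneg 'y))))).
apply: variety_ext (variety_models (E :: nil)) => A; split.
- by move=> H x y; have [] := H (assign x y y).
- by move=> H v; split=> //; apply: H.
Qed.

Lemma variety_SDM : variety SDM.
Proof.
pose E := (Bneg (Meet 'x 'y), Join (Bneg 'x) (Bneg 'y)).
apply: variety_ext (variety_models (E :: nil)) => A; split.
- by move=> H x y; have [] := H (assign x y y).
- by move=> H v; split=> //; apply: H.
Qed.

Lemma variety_WSDM : variety WSDM.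
Proof.
pose E := (Bneg (Meet 'x (Bneg 'y)), Join (Bneg 'x) (Dia 'y)).
apply: variety_ext (variety_models (E :: nil)) => A; split.
- by move=> H x y; have [] := H (assign x y y).
- by move=> H v; split=> //; apply: H.
Qed.

Lemma variety_SK : variety SK.
Proof.
pose E := Le (Meet 'x (Dia 'y)) (Join (Bneg (Kneg 'x)) 'y).
apply: variety_ext (variety_models (E :: nil)) => A; split.
- by move=> H x y; have [] := H (assign x y y).
- by move=> H v; split=> //; apply: H.
Qed.

(** * Bounded involution lattices and BZ-lattices *)

Section BoundedLattice.
Context (A : algebra) (L : bounded_lattice A).
Implicit Types x y z : A.

Lemma meetC x y : x `&` y = y `&` x. Proof. exact: bl_meetC. Qed.
Lemma joinC x y : x `|` y = y `|` x. Proof. exact: bl_joinC. Qed.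

Lemma meetxx x : x `&` x = x.
Proof. by rewrite -{2}(bl_joinK L x x) bl_meetK. Qed.

Lemma le_refl x : x <= x. Proof. exact: meetxx. Qed.

Lemma le_trans y x z : x <= y -> y <= z -> x <= z.
Proof. by move=> xy yz; rewrite /le -{1}xy -bl_meetA // yz. Qed.

Lemma le_anti x y : x <= y -> y <= x -> x = y.
Proof. by move=> xy yx; rewrite -xy -[RHS]yx meetC. Qed.

Lemma le_joinP x y : x <= y <-> x `|` y = y.
Proof.
split=> [<-|<-]; last exact: bl_meetK.
by rewrite joinC meetC bl_joinK.
Qed.

Lemma le_meetl x y : x `&` y <= x.
Proof. by rewrite /le meetC bl_meetA // meetxx. Qed.

Lemma le_meetr x y : x `&` y <= y.
Proof. by rewrite meetC; exact: le_meetl. Qed.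

Lemma le_meet x y z : z <= x -> z <= y -> z <= x `&` y.
Proof. by move=> zx zy; rewrite /le bl_meetA // zx. Qed.

Lemma le_joinl x y : x <= x `|` y. Proof. exact: bl_meetK. Qed.

Lemma le_joinr x y : y <= x `|` y.
Proof. by rewrite joinC; exact: le_joinl. Qed.

Lemma le_join x y z : x <= z -> y <= z -> x `|` y <= z.
Proof.
move=> /le_joinP xz /le_joinP yz.
by apply/le_joinP; rewrite -bl_joinA // yz.
Qed.

Lemma le_meet2 x y x' y' : x <= x' -> y <= y' -> x `&` y <= x' `&` y'.
Proof.
move=> xx' yy'; apply: le_meet; first exact: le_trans (le_meetl _ _) xx'.
exact: le_trans (le_meetr _ _) yy'.
Qed.

Lemma meet0x x : 0 `&` x = 0. Proof. exact: bl_bot. Qed.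
Lemma meetx0 x : x `&` 0 = 0. Proof. by rewrite meetC meet0x. Qed.
Lemma meetx1 x : x `&` 1 = x. Proof. exact: bl_top. Qed.
Lemma meet1x x : 1 `&` x = x. Proof. by rewrite meetC meetx1. Qed.
Lemma join0x x : 0 `|` x = x. Proof. exact/le_joinP/bl_bot. Qed.
Lemma joinx0 x : x `|` 0 = x. Proof. by rewrite joinC join0x. Qed.
Lemma joinx1 x : x `|` 1 = 1. Proof. exact/le_joinP/bl_top. Qed.
Lemma join1x x : 1 `|` x = 1. Proof. by rewrite joinC joinx1. Qed.

Lemma le0_eq x : x <= 0 -> x = 0.
Proof. by move=> x0; apply: le_anti => //; exact: bl_bot. Qed.

Lemma le1_eq x : 1 <= x -> x = 1.
Proof. by move=> x1; apply: le_anti => //; exact: bl_top. Qed.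

End BoundedLattice.

Section InvolutionLattice.
Context (A : algebra) (I : bounded_involution_lattice A).
Let L : bounded_lattice A := bi_lattice I.
Implicit Types x y z : A.

Lemma kneg_le x y : kneg x <= y -> kneg y <= x.
Proof. by move=> xy; rewrite -(bi_knegK I x); exact: bi_kneg_anti. Qed.

Lemma kneg0 : kneg 0 = 1 :> A.
Proof.
apply: (le1_eq L); rewrite -[1](bi_knegK I).
by apply: (bi_kneg_anti I); exact: bl_bot.
Qed.

Lemma kneg1 : kneg 1 = 0 :> A.
Proof. by rewrite -kneg0 bi_knegK. Qed.

Lemma kneg_meet x y : kneg (x `&` y) = kneg x `|` kneg y.
Proof.
apply: (le_anti L).
- apply: kneg_le; apply: (le_meet L); apply: kneg_le.
  + exact: (le_joinl L).
  + exact: (le_joinr L).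
- by apply: (le_join L); apply: (bi_kneg_anti I); [exact: le_meetl|exact: le_meetr].
Qed.

Lemma kneg_join x y : kneg (x `|` y) = kneg x `&` kneg y.
Proof. by rewrite -[RHS](bi_knegK I) kneg_meet !(bi_knegK I). Qed.

End InvolutionLattice.

Section BZLattice.
Context (A : algebra) (Z : BZ_lattice A).
Let I : bounded_involution_lattice A := pk_involution (bz_pseudo_kleene Z).
Let L : bounded_lattice A := bi_lattice I.
Implicit Types x y z p q : A.

Lemma bneg3 x : bneg (bneg (bneg x)) = bneg x.
Proof.
by apply: (le_anti L); [apply: (bz_bneg_anti Z)|]; exact: (bz_le_dia Z).
Qed.

Lemma bneg1 : bneg 1 = 0 :> A.
Proof. by rewrite -(bz_meet_bneg Z 1) (meet1x L). Qed.

Lemma bneg0 : bneg 0 = 1 :> A.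
Proof. by apply: (le1_eq L); rewrite -bneg1; exact: (bz_le_dia Z). Qed.

Lemma bneg_le_kneg x : bneg x <= kneg x.
Proof.
rewrite -[bneg x](bi_knegK I) (bz_kneg_bneg Z).
by apply: (bi_kneg_anti I); exact: (bz_le_dia Z).
Qed.

Lemma box_le x : box x <= x.
Proof. by rewrite -{2}(bi_knegK I x); exact: bneg_le_kneg. Qed.

Lemma closed_kneg p : dia p = p -> kneg p = bneg p.
Proof. by rewrite /dia => pp; rewrite -{1}pp (bz_kneg_bneg Z) bneg3. Qed.

Lemma closed_meet p q : dia p = p -> dia q = q -> dia (p `&` q) = p `&` q.
Proof.
move=> pp qq; apply: (le_anti L); last exact: (bz_le_dia Z).
apply: (le_meet L); [rewrite -{2}pp|rewrite -{2}qq];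
  do 2!apply: (bz_bneg_anti Z).
- exact: le_meetl.
- exact: le_meetr.
Qed.

Definition closed_paraorthomodular : Prop :=
  forall p q, dia p = p -> dia q = q -> q <= p -> p `&` kneg q = 0 -> q = p.

(** The orthomodular law for the pair [dia x /\ dia y <= dia x], written as a single inequality and
    hence as an identity. *)
Definition closed_orthomodular : Prop :=
  forall x y, dia x `&` (kneg (dia x) `|` (dia x `&` dia y)) <= dia y.

(** From left to right, p /\ q' = 0 gives p' \/ q = 1, and the law collapses to p <= q. *)
Lemma closed_orthomodularP : closed_orthomodular <-> closed_paraorthomodular.
Proof.
split=> [om p q pp qq qp pq0|pm x y].
- have := om p q; rewrite pp qq (meetC L p q) qp.
  have -> : kneg p `|` q = 1.
    by rewrite -(kneg0 I) -pq0 (kneg_meet I) (bi_knegK I).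
  by rewrite (meetx1 L) => pq; exact: (le_anti L).
- set p := dia x; set r := p `&` dia y.
  have cp : dia p = p by exact: bneg3.
  have cr : dia r = r by apply: closed_meet => //; exact: bneg3.
  (* [c] is the complement of [r] relative to [p]. Both [r <= p /\ c~] and (p /\ c~) /\ r' = c /\ c~
     = 0 hold, so paraorthomodularity equates [r] with [p /\ c~]. *)
  set c := p `&` kneg r.
  have cc : dia c = c by apply: closed_meet => //; rewrite closed_kneg //; exact: bneg3.
  have -> : kneg p `|` r = bneg c.
    by rewrite -closed_kneg // (kneg_meet I) (bi_knegK I).
  have <- : r = p `&` bneg c; last exact: le_meetr.
  apply: pm => //.
  + by apply: closed_meet => //; exact: bneg3.
  + apply: (le_meet L); first exact: le_meetl.
    rewrite -closed_kneg // (kneg_meet I) (bi_knegK I); exact: (le_joinr L).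
  + by rewrite -(bl_meetA L) (meetC L (bneg c)) (bl_meetA L) (bz_meet_bneg Z).
Qed.

Hypothesis star : forall x, bneg (x `&` kneg x) <= bneg x `|` box x.

(** If x /\ x' = 0, the star axiom gives x~ \/ box x = 1, that is, dia x /\ (box x)' = 0.
    Paraorthomodularity then collapses the interval from [box x] to [dia x], which contains [x]. *)
Lemma sharp_closed x :
  closed_paraorthomodular -> x `&` kneg x = 0 -> dia x = x.
Proof.
move=> pm x0.
have cb : dia (box x) = box x by exact: bneg3.
suff bd : box x = dia x.
  by apply: (le_anti L); [rewrite -bd; exact: box_le|exact: (bz_le_dia Z)].
apply: pm => //; first exact: bneg3.
- exact: (le_trans L (box_le x) (bz_le_dia Z x)).
- have := star x; rewrite x0 bneg0 => /(le1_eq L) e.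
  by rewrite -(kneg1 I) -e (kneg_join I) (bz_kneg_bneg Z).
Qed.

(** When x <= y, both x /\ x' and y /\ y' lie below x' /\ y. If the latter is 0, then [x] and [y]
    are sharp, hence closed. *)
Lemma paraorthomodularP : paraorthomodular A <-> closed_paraorthomodular.
Proof.
split=> [pm p q _ _ qp pq0|pm x y xy xy0].
- by apply: pm => //; rewrite (meetC L).
- have x0 : x `&` kneg x = 0.
    apply: (le0_eq L); rewrite -xy0 (meetC L (kneg x)).
    exact: (le_meet2 L xy (le_refl L _)).
  have y0 : y `&` kneg y = 0.
    apply: (le0_eq L); rewrite -xy0 (meetC L (kneg x)).
    exact: (le_meet2 L (le_refl L _) (bi_kneg_anti I xy)).
  apply: (pm) => //; last by rewrite (meetC L).
  + exact: sharp_closed pm y0.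
  + exact: sharp_closed pm x0.
Qed.

End BZLattice.

(** * Varieties of PBZ*-lattices *)

(** Antitonicity is made equational through the comparable pair x /\ y <= y, and
    [closed_orthomodular] replaces paraorthomodularity. *)
Definition PBZL_axioms : list (term * term) :=
  (Meet 'x (Meet 'y 'z), Meet (Meet 'x 'y) 'z) ::
  (Join 'x (Join 'y 'z), Join (Join 'x 'y) 'z) ::
  (Meet 'x 'y, Meet 'y 'x) ::
  (Join 'x 'y, Join 'y 'x) ::
  (Meet 'x (Join 'x 'y), 'x) ::
  (Join 'x (Meet 'x 'y), 'x) ::
  Le Bot 'x ::
  Le 'x Top ::
  (Kneg (Kneg 'x), 'x) ::
  Le (Kneg 'y) (Kneg (Meet 'x 'y)) ::
  Le (Meet 'x (Kneg 'x)) (Join 'y (Kneg 'y)) ::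
  (Meet 'x (Bneg 'x), Bot) ::
  Le 'x (Dia 'x) ::
  Le (Bneg 'y) (Bneg (Meet 'x 'y)) ::
  (Kneg (Bneg 'x), Dia 'x) ::
  Le (Bneg (Meet 'x (Kneg 'x))) (Join (Bneg 'x) (Bneg (Kneg 'x))) ::
  Le (Meet (Dia 'x) (Join (Kneg (Dia 'x)) (Meet (Dia 'x) (Dia 'y)))) (Dia 'y) ::
  nil.

Lemma PBZL_models : class_eq (models PBZL_axioms) PBZL.
Proof.
move=> A; split=> [H|P v].
- have {}H x y z := H (assign x y z).
  have L : bounded_lattice A.
    by split=> [x y z|x y z|x y|x y|x y|x y|x|x];
      [have := H x y z|have := H x y z|have := H x y y|have := H x y y
      |have := H x y y|have := H x y y|have := H x x x|have := H x x x];
      rewrite /=; tauto.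
  have I : bounded_involution_lattice A.
    split=> // [x|x y xy]; first by have := H x x x; rewrite /=; tauto.
    by rewrite -xy; have := H x y y; rewrite /=; tauto.
  have Z : BZ_lattice A.
    split; first split=> //.
    + by move=> x y; have := H x y y; rewrite /=; tauto.
    + by move=> x; have := H x x x; rewrite /=; tauto.
    + by move=> x; have := H x x x; rewrite /=; tauto.
    + by move=> x y xy; rewrite -xy; have := H x y y; rewrite /=; tauto.
    + by move=> x; have := H x x x; rewrite /=; tauto.
  have star (x : A) : bneg (x `&` kneg x) <= bneg x `|` box x.
    by have := H x x x; rewrite /=; tauto.
  split=> //; apply/(paraorthomodularP Z star).
  apply/closed_orthomodularP => // x y.
  by have := H x y y; rewrite /=; tauto.
- have [Z star /(paraorthomodularP Z star)/(closed_orthomodularP Z) om] := P.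
  have [[I kl] mb ld ba kb] := Z; have [L kK ka] := I.
  have ml (x y : A) : x `&` y <= y by exact: le_meetr.
  have [mA jA mC jC mK jK b t] := L.
  rewrite /=; do ![split=> //]; first
    [exact: mA|exact: jA|exact: mC|exact: jC|exact: mK|exact: jK|exact: b|exact: t
    |exact/ka/ml|exact/ba/ml|exact: ld|exact: kl|exact: star|exact: om].
Qed.

Lemma variety_PBZL : variety PBZL.
Proof. exact: variety_ext PBZL_models (variety_models _). Qed.

Lemma subvariety_PBZL (V : class) :
  variety V -> subvariety (fun A => PBZL A /\ V A).
Proof. by move=> vV; split=> [|A []//]; exact: variety_and variety_PBZL vV. Qed.

Lemma subvariety_V1 : subvariety V1.
Proof.
have [v s] := subvariety_PBZL (variety_and variety_J2 variety_WSDM).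
split=> [|A []//]; apply: variety_ext v => A.
by split=> [[? []]|[]].
Qed.

Lemma subvariety_V2 : subvariety V2.
Proof.
have [v s] := subvariety_PBZL (variety_and variety_J2 variety_SDM).
split=> [|A []//]; apply: variety_ext v => A.
by split=> [[? []]|[]].
Qed.

Lemma subvariety_V3 : subvariety V3.
Proof.
have v := variety_and subvariety_V1.1 variety_SK.
split=> [|A []//]; apply: variety_ext v => A.
by split=> [[[]]|[]].
Qed.

(** * Congruences and subdirect representation *)

Record congruence (A : algebra) (R : A -> A -> Prop) : Prop := Congruence {
  cg_refl : forall x, R x x;
  cg_sym : forall x y, R x y -> R y x;
  cg_trans : forall x y z, R x y -> R y z -> R x z;
  cg_meet : forall x x' y y', R x x' -> R y y' -> R (x `&` y) (x' `&` y');
  cg_join : forall x x' y y', R x x' -> R y y' -> R (x `|` y) (x' `|` y');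
  cg_kneg : forall x x', R x x' -> R (kneg x) (kneg x');
  cg_bneg : forall x x', R x x' -> R (bneg x) (bneg x')
}.

Lemma congruence_eq (A : algebra) : congruence (@eq A).
Proof. by split=> // [x y z ->|x x' y y' -> ->|x x' y y' -> ->|x x' ->|x x' ->]. Qed.

Lemma congruence_preim (A B : algebra) (f : A -> B) (R : B -> B -> Prop) :
  hom f -> congruence R -> congruence (fun x y => R (f x) (f y)).
Proof.
move=> hf [rr rs rt rm rj rk rb]; split.
- by move=> x; exact: rr.
- by move=> x y; exact: rs.
- by move=> x y z; exact: rt.
- by move=> x x' y y' xx' yy'; rewrite !(hom_meet hf); exact: rm.
- by move=> x x' y y' xx' yy'; rewrite !(hom_join hf); exact: rj.
- by move=> x x' xx'; rewrite !(hom_kneg hf); exact: rk.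
- by move=> x x' xx'; rewrite !(hom_bneg hf); exact: rb.
Qed.

(* [R] is only required to be a congruence after adding the diagonal, so that
   the union of an empty chain is allowed in Zorn's lemma. *)
Lemma maximal_congruence (A : algebra) (a b : A) : a <> b ->
  exists2 R : A -> A -> Prop, congruence R /\ ~ R a b &
    forall S : A -> A -> Prop, congruence S -> ~ S a b ->
      (forall x y, R x y -> S x y) -> forall x y, S x y -> R x y.
Proof.
move=> ab.
pose D (X : set (A * A)) x y := x = y \/ X (x, y).
pose P (X : set (A * A)) := congruence (D X) /\ ~ X (a, b).
have [F PF totF|X [[cX Xab] maxX]] := @Zorn_bigcup _ P.
- split; last by move=> [X FX]; exact: (PF X FX).2.
  set U := D _.
  have DU X : F X -> forall x y, D X x y -> U x y.
    by move=> FX x y [->|Xxy]; [left|right; exists X].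
  (* One or two related pairs of the union always lie in a single congruence inside [U]: equality or
     a member of the chain. Each closure property is then inherited from that congruence. *)
  have U1 x y : U x y -> exists R, [/\ congruence R, R x y &
      forall x y, R x y -> U x y].
    move=> [->|[X FX Xxy]].
      by exists eq; split=> //; [exact: congruence_eq|move=> ? ?; left].
    by exists (D X); split; [exact: (PF X FX).1|right|exact: DU].
  have U2 x x' y y' : U x x' -> U y y' -> exists R, [/\ congruence R, R x x',
      R y y' & forall x y, R x y -> U x y].
    move=> [->|[X FX Xx]].
      by move=> /U1[R [cR Ry RU]]; exists R; split=> //; exact: cg_refl.
    move=> [->|[Y FY Yy]].
      exists (D X); split; [exact: (PF X FX).1|by right|by left|exact: DU].
    have [XY|YX] := totF _ _ FX FY.
    + exists (D Y); split; [exact: (PF Y FY).1|right; exact: XY|by right|exact: DU].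
    + exists (D X); split; [exact: (PF X FX).1|by right|right; exact: YX|exact: DU].
  split.
  + by left.
  + by move=> x y /U1[R [cR Rx RU]]; apply/RU/(cg_sym cR).
  + by move=> x y z xy /(U2 _ _ _ _ xy)[R [cR Rx Ry RU]];
      exact/RU/(cg_trans cR Rx Ry).
  + by move=> x x' y y' xx' /(U2 _ _ _ _ xx')[R [cR Rx Ry RU]];
      exact/RU/(cg_meet cR Rx Ry).
  + by move=> x x' y y' xx' /(U2 _ _ _ _ xx')[R [cR Rx Ry RU]];
      exact/RU/(cg_join cR Rx Ry).
  + by move=> x x' /U1[R [cR Rx RU]]; exact/RU/(cg_kneg cR Rx).
  + by move=> x x' /U1[R [cR Rx RU]]; exact/RU/(cg_bneg cR Rx).
- exists (D X); first by split=> // -[].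
  move=> S cS Sab XS x y Sxy; right.
  apply: contrapT => nXxy; apply: (maxX [set u | S u.1 u.2]%classic).
    split; first by move=> [u v] Xuv; apply: XS; right.
    by move=> /(_ (x, y) Sxy).
  split=> //.
  have -> // : D [set u | S u.1 u.2]%classic = S.
  apply: funext => u; apply: funext => v; apply: propext; split=> [[->|]//|Suv].
    exact: cg_refl.
  by right.
Qed.

Section Quotient.
Context (A : algebra) (R : A -> A -> Prop) (cR : congruence R).

(** Elements are congruence classes as predicates, so related elements have equal classes by
    extensionality; the operations use chosen representatives. *)
Definition quotient_type : Type := {X : A -> Prop | exists x, X = R x}.

Definition to_quotient (x : A) : quotient_type := exist _ (R x) (ex_intro _ x erefl).

Definition repr (X : quotient_type) : A := projT1 (cid (projT2 X)).

Lemma to_quotientP (x y : A) : to_quotient x = to_quotient y <-> R x y.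
Proof.
split=> [[->]|xy]; first exact: cg_refl.
apply: eq_exist; apply: funext => z; apply: propext.
by split; [exact/(cg_trans cR)/(cg_sym cR)|exact: (cg_trans cR)].
Qed.

Lemma reprK : cancel repr to_quotient.
Proof.
move=> [X eX]; rewrite /repr /=; case: cid => x /= Xx.
exact: eq_exist.
Qed.

Lemma repr_to_quotient (x : A) : R (repr (to_quotient x)) x.
Proof. by apply/to_quotientP; rewrite reprK. Qed.

Definition quotient : algebra := {|
  carrier := quotient_type;
  meet := fun x y => to_quotient (repr x `&` repr y);
  join := fun x y => to_quotient (repr x `|` repr y);
  kneg := fun x => to_quotient (kneg (repr x));
  bneg := fun x => to_quotient (bneg (repr x));
  bot := to_quotient 0;
  top := to_quotient 1
|}.

Lemma to_quotient_hom : hom (to_quotient : A -> quotient).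
Proof.
have rq x : R x (repr (to_quotient x)) by exact/(cg_sym cR)/repr_to_quotient.
split=> //= [x y|x y|x|x]; apply/to_quotientP.
- exact: cg_meet.
- exact: cg_join.
- exact: cg_kneg.
- exact: cg_bneg.
Qed.

End Quotient.

(** Subdirect irreducibility: the pair (a, b) lies in every congruence other than equality. *)
Definition monolithic (A : algebra) : Prop :=
  exists a b : A, a <> b /\ forall R : A -> A -> Prop,
    congruence R -> ~ R a b -> forall x y, R x y -> x = y.

(** Divide by a congruence maximal among those separating [a] and [b]. A congruence of the quotient
    that separates their images pulls back to one above [R], hence to [R] itself. *)
Lemma monolithic_quotient (A : algebra) (a b : A) : a <> b ->
  exists B : algebra, exists f : A -> B,
    [/\ hom f, forall y, exists x, f x = y, f a <> f b & monolithic B].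
Proof.
move=> /maximal_congruence[R [cR Rab] maxR].
have hq := to_quotient_hom cR.
have nab : to_quotient R a <> to_quotient R b by move=> /(to_quotientP cR).
exists (quotient R), (to_quotient R); split=> //.
  by move=> y; exists (repr y); exact: reprK.
exists (to_quotient R a), (to_quotient R b); split=> // S cS Sab x y.
rewrite -(reprK x) -(reprK y) => Sxy; apply/(to_quotientP cR).
apply: (maxR _ (congruence_preim hq cS) Sab _ _ _ Sxy) => u v /(to_quotientP cR) ->.
exact: (cg_refl cS).
Qed.

(** The separating maps, indexed by the pairs of distinct elements, embed [A] into a product of
    members of [V]. *)
Lemma variety_separated (V : class) (A : algebra) : variety V ->
  (forall a b : A, a <> b -> exists B : algebra, exists f : A -> B,
    [/\ hom f, V B & f a <> f b]) -> V A.
Proof.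
move=> vV sep.
pose I := {p : A * A | p.1 <> p.2}.
pose B (i : I) := projT1 (cid (sep _ _ (projT2 i))).
have Bf (i : I) : {f : A -> B i | [/\ hom f, V (B i) &
    f (projT1 i).1 <> f (projT1 i).2]}.
  exact: cid (projT2 (cid (sep _ _ (projT2 i)))).
pose f (x : A) : product B := fun i => projT1 (Bf i) x.
have fP i := projT2 (Bf i).
apply: (variety_S vV (f := f)); last by apply: (variety_P vV) => i; have [] := fP i.
- split=> [x y|x y|x|x||]; apply: functional_extensionality_dep => i;
    have [[fm fj fk fb f0 f1] _ _] := fP i.
  + exact: fm.
  + exact: fj.
  + exact: fk.
  + exact: fb.
  + exact: f0.
  + exact: f1.
- move=> x y fxy; apply: contrapT => xy.
  pose i : I := exist _ (x, y) xy.
  by have [_ _] := fP i; apply; exact: (congr1 (fun g : product B => g i) fxy).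
Qed.

(** Birkhoff's subdirect representation: inclusions of varieties may be tested on subdirectly
    irreducible algebras. *)
Lemma subclass_monolithic (V W : class) : variety V -> variety W ->
  (forall A, monolithic A -> V A -> W A) -> subclass V W.
Proof.
move=> vV vW VW A VA; apply: (variety_separated vW) => a b.
move=> /monolithic_quotient[B [f [hf surj fab mB]]].
by exists B, f; split=> //; apply: VW => //; exact: (variety_H vV hf surj).
Qed.

(** * Monolithic algebras satisfying J2 and WSDM *)

Section Factor.
Context (A : algebra) (Z : BZ_lattice A) (wsdm : WSDM A).
Let I : bounded_involution_lattice A := pk_involution (bz_pseudo_kleene Z).
Let L : bounded_lattice A := bi_lattice I.
Implicit Types x y c : A.

(** J2 says that every [c] of the form y /\ y' is splitting. *)
Definition splitting c : Prop :=
  forall x, x = (x `&` bneg c) `|` (x `&` dia c).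

Lemma splitting_bneg c : splitting c -> splitting (bneg c).
Proof. by move=> sc x; rewrite /dia (bneg3 Z) (joinC L); exact: sc. Qed.

Definition factor c x y : Prop := x `&` bneg c = y `&` bneg c.

(** Split x' and negate; the negation interchanges [bneg c] and [dia c]. *)
Lemma splitting_dual c : splitting c ->
  forall x, x = (x `|` dia c) `&` (x `|` bneg c).
Proof.
move=> sc x; rewrite -{1}[x](bi_knegK I) {1}(sc (kneg x)) (kneg_join I) !(kneg_meet I).
by rewrite !(bi_knegK I) !(bz_kneg_bneg Z) (bneg3 Z).
Qed.

(** For q = x /\ c~ the dual splitting gives q = (q \/ dia c) /\ c~, while splitting [x] gives x <=
    q \/ dia c. *)
Lemma join_dia_meet c : splitting c ->
  forall x, (x `|` dia c) `&` bneg c = x `&` bneg c.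
Proof.
move=> sc x; apply: (le_anti L); last exact: (le_meet2 L (le_joinl L _ _) (le_refl L _)).
set q := x `&` bneg c.
have -> : q = (q `|` dia c) `&` bneg c.
  rewrite {1}(splitting_dual sc q); congr (_ `&` _).
  exact/(le_joinP L)/(le_meetr L).
apply: (le_meet2 L); last exact: (le_refl L).
apply: (le_join L); last exact: (le_joinr L).
rewrite {1}(sc x); apply: (le_join L); first exact: (le_joinl L).
exact: (le_trans L (le_meetr L _ _) (le_joinr L _ _)).
Qed.

(** With [q] the right-hand side, [x] and [y] lie below q \/ dia c, hence so does their join;
    meeting with c~ leaves [q] by [join_dia_meet]. *)
Lemma meet_distr c : splitting c ->
  forall x y, (x `|` y) `&` bneg c = (x `&` bneg c) `|` (y `&` bneg c).
Proof.
move=> sc x y; set q := _ `|` (y `&` _); apply: (le_anti L); last first.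
  by apply: (le_join L); apply: (le_meet2 L);
    [exact: (le_joinl L)|exact: (le_refl L)|exact: (le_joinr L)|exact: (le_refl L)].
have le_q z : z `&` bneg c <= q -> z <= q `|` dia c.
  move=> zq; rewrite {1}(sc z); apply: (le_join L).
    exact: (le_trans L zq (le_joinl L _ _)).
  exact: (le_trans L (le_meetr L _ _) (le_joinr L _ _)).
have xyq : x `|` y <= q `|` dia c.
  by apply: (le_join L); apply: le_q; [exact: (le_joinl L)|exact: (le_joinr L)].
apply: (le_trans L (le_meet2 L xyq (le_refl L _))).
by rewrite (join_dia_meet sc); exact: (le_meetl L).
Qed.

(** WSDM serves compatibility with ~: (x /\ c~)~ = x~ \/ dia c, which has the same meet with c~ as
    x~. *)
Lemma congruence_factor c : splitting c -> congruence (factor c).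
Proof.
move=> sc; rewrite /factor.
have meet_e x y : (x `&` y) `&` bneg c = (x `&` bneg c) `&` (y `&` bneg c).
  rewrite -!(bl_meetA L) (bl_meetA L (bneg c)) (meetC L (bneg c) y).
  by rewrite -(bl_meetA L y) (meetxx L).
have kneg_e x : kneg x `&` bneg c = kneg (x `&` bneg c) `&` bneg c.
  by rewrite (kneg_meet I) (bz_kneg_bneg Z) (join_dia_meet sc).
have bneg_e x : bneg x `&` bneg c = bneg (x `&` bneg c) `&` bneg c.
  by rewrite wsdm (join_dia_meet sc).
split=> //.
- by move=> x y z -> ->.
- by move=> x x' y y' xx' yy'; rewrite meet_e xx' yy' -meet_e.
- by move=> x x' y y' xx' yy'; rewrite (meet_distr sc) xx' yy' -(meet_distr sc).
- by move=> x x' xx'; rewrite kneg_e xx' -kneg_e.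
- by move=> x x' xx'; rewrite bneg_e xx' -bneg_e.
Qed.

(** The two factor congruences cannot both identify [a] and [b], so one of them is equality. As
    [factor d] identifies d~ with 1, the corresponding d~ is 1. *)
Lemma monolithic_splitting c :
  monolithic A -> splitting c -> bneg c = 1 \/ dia c = 1.
Proof.
move=> [a [b [ab triv]]] sc.
have sc' := splitting_bneg sc.
have sep d : splitting d -> ~ factor d a b -> bneg d = 1.
  move=> sd /(triv _ (congruence_factor sd)); apply.
  by rewrite /factor (meet1x L) (meetxx L).
have [e1|] := EM (factor c a b); last by left; exact: sep.
have [e2|] := EM (factor (bneg c) a b); last by right; exact: sep.
by case: ab; rewrite (sc a) (sc b) e1; congr (_ `|` _).
Qed.

End Factor.

(** * Orthomodular lattices and antiortholattices among PBZ*-lattices *)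

Section PBZLattice.
Context (A : algebra) (P : PBZL A).
Let Z : BZ_lattice A := pbz_bz P.
Let I : bounded_involution_lattice A := pk_involution (bz_pseudo_kleene Z).
Let L : bounded_lattice A := bi_lattice I.
Implicit Types x y z : A.

Lemma PBZL_sharp_closed x : x `&` kneg x = 0 -> dia x = x.
Proof.
apply: (sharp_closed Z); first exact: pbz_star.
by apply/(paraorthomodularP Z (pbz_star P)); exact: pbz_paraorthomodular.
Qed.

Lemma monolithic_OML_AOL : WSDM A -> J2 A -> monolithic A -> OML A \/ AOL A.
Proof.
move=> wsdm j2 mA.
have two y : bneg (y `&` kneg y) = 1 \/ dia (y `&` kneg y) = 1.
  by apply: (monolithic_splitting Z wsdm mA) => x; exact: j2.
have [[y yd]|nd] := EM (exists y, dia (y `&` kneg y) = 1).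
- right; split=> // s; split; last first.
    by case=> ->; rewrite ?(meet0x L) // (kneg1 I) (meetx0 L).
  move=> s0; have ss := PBZL_sharp_closed s0.
  set w := y `&` kneg y in yd.
  have w0 : bneg w = 0 by rewrite -(bneg3 Z) [bneg (bneg w)]yd (bneg1 Z).
  have ww : w <= kneg w.
    rewrite /w (kneg_meet I) (bi_knegK I) (joinC L).
    exact: pk_kleene (bz_pseudo_kleene Z) _ _.
  have := two (w `&` s).
  have -> : (w `&` s) `&` kneg (w `&` s) = w `&` s.
    apply: (le_trans L (le_meetl L _ _)); apply: (le_trans L ww).
    exact/(bi_kneg_anti I)/(le_meetl L).
  have ws : bneg (w `&` s) = bneg s.
    by rewrite -{1}ss wsdm w0 (join0x L) /dia (bneg3 Z).
  rewrite /dia ws => -[s1|s1]; rewrite -ss /dia; last by right.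
  by left; rewrite s1 (bneg1 Z).
- left; split=> // x.
  (* Here (x /\ x')~ = 1, and any element meets its ~ in 0. *)
  have xs : x `&` kneg x = 0.
    have [x1|x1] := two x; last by case: nd; exists x.
    by rewrite -[LHS](meetx1 L) -x1 (bz_meet_bneg Z).
  by rewrite (closed_kneg Z) // PBZL_sharp_closed.
Qed.

Lemma OML_J2 : OML A -> J2 A.
Proof.
move=> [_ e] x y; rewrite -e (bz_meet_bneg Z) /dia (bneg0 Z) (bneg1 Z).
by rewrite (meetx1 L) (meetx0 L) (joinx0 L).
Qed.

Lemma SDM_WSDM : SDM A -> WSDM A.
Proof. by move=> sdm x y; rewrite sdm. Qed.

Lemma OML_SDM : OML A -> SDM A.
Proof. by move=> [_ e] x y; rewrite !e (kneg_meet I). Qed.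

Lemma OML_SK : OML A -> SK A.
Proof.
move=> [_ e] x y; rewrite /dia /box !e !(bi_knegK I).
exact: (le_trans L (le_meetl L _ _) (le_joinl L _ _)).
Qed.

(** The element x~ is sharp, hence 0 or 1, and x~ = 1 would force x = x /\ x~ = 0. *)
Lemma AOL_bneg x : AOL A -> x <> 0 -> bneg x = 0.
Proof.
move=> [_ aol] x0; have /aol[//|x1] : bneg x `&` kneg (bneg x) = 0.
  by rewrite (bz_kneg_bneg Z) (bz_meet_bneg Z).
by case: x0; rewrite -(bz_meet_bneg Z x) x1 (meetx1 L).
Qed.

Lemma AOL_J2 : AOL A -> J2 A.
Proof.
move=> aol x y; have [->|y0] := EM (y `&` kneg y = 0).
  by rewrite /dia (bneg0 Z) (bneg1 Z) (meetx1 L) (meetx0 L) (joinx0 L).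
by rewrite /dia (AOL_bneg aol y0) (bneg0 Z) (meetx1 L) (meetx0 L) (join0x L).
Qed.

Lemma AOL_WSDM : AOL A -> WSDM A.
Proof.
move=> aol x y; have [->|y0] := EM (y = 0).
  by rewrite /dia (bneg0 Z) (bneg1 Z) (meetx1 L) (joinx0 L).
by rewrite /dia (AOL_bneg aol y0) (bneg0 Z) (meetx0 L) (bneg0 Z) (joinx1 L).
Qed.

End PBZLattice.

(** * The three-element chain and antiortholattices satisfying SK *)

Lemma PBZL_D3 : PBZL D3.
Proof.
split; [split; [split; [split; [split|..]|]|..]|..];
  first [by case|by do 2!case|by do 3!case].
Qed.

Lemma AOL_D3 : AOL D3.
Proof.
split; first exact: PBZL_D3.
by case; split=> //; [left|case|right].
Qed.

Lemma V3_D3 : V3 D3.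
Proof.
have P := PBZL_D3; split=> //.
- exact: (AOL_J2 P AOL_D3).
- exact: (AOL_WSDM P AOL_D3).
- by do 2!case.
Qed.

Definition to_D3 (A : algebra) (x : A) : D3 :=
  if pselect (x = 0) then c0 else if pselect (x = 1) then c1 else cd.

(** If x is not 1 and y is not 0, then box x = 0 and dia y = 1, so SK reads x <= y. Hence at most
    one element differs from 0 and 1, and [to_D3] is an embedding. *)
Lemma AOL_SK_generated (A : algebra) : (0 : A) <> 1 -> AOL A -> SK A ->
  generated_variety (singleton_class D3) A.
Proof.
move=> n01 aol sk V vV VD.
have P : PBZL A by case: aol.
have Z := pbz_bz P.
have I := pk_involution (bz_pseudo_kleene Z).
have L := bi_lattice I.
have k0 := kneg0 I; have k1 := kneg1 I.
have le_mid (x y : A) : x <> 1 -> y <> 0 -> x <= y.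
  move=> x1 y0; have := sk x y; rewrite /box /dia (AOL_bneg P aol y0).
  have kx0 : kneg x <> 0 by move=> kx; apply: x1; rewrite -(bi_knegK I x) kx.
  by rewrite (AOL_bneg P aol kx0) (bneg0 Z) (meetx1 L) (join0x L).
have mid (x y : A) : x <> 0 -> x <> 1 -> y <> 0 -> y <> 1 -> x = y.
  by move=> x0 x1 y0 y1; apply: (le_anti L); exact: le_mid.
have kmid (x : A) : x <> 0 -> x <> 1 -> kneg x = x.
  move=> x0 x1; apply: mid => // kx; [apply: x1|apply: x0];
    by rewrite -(bi_knegK I x) kx.
have t0 : to_D3 (0 : A) = c0 by rewrite /to_D3; case: pselect.
have t1 : to_D3 (1 : A) = c1.
  rewrite /to_D3; case: (pselect (1 = 0 :> A)) => [e|n]; last by case: pselect.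
  by case: n01.
have td (x : A) : x <> 0 -> x <> 1 -> to_D3 x = cd.
  by move=> x0 x1; rewrite /to_D3; case: (pselect (x = 0)) => // n; case: pselect.
(* An eliminator that lets [A] be treated like the chain with constructors 0, middle and 1. *)
have cases (Q : A -> Prop) : Q 0 -> Q 1 -> (forall x, x <> 0 -> x <> 1 -> Q x) ->
    forall x, Q x.
  move=> Q0 Q1 Qd x; have [->//|x0] := EM (x = 0); have [->//|x1] := EM (x = 1).
  exact: Qd.
have hf : hom (@to_D3 A).
  split=> //.
  - elim/cases=> [y|y|x x0 x1].
    + by rewrite (meet0x L) t0.
    + by rewrite (meet1x L) t1; case: (to_D3 y).
    + elim/cases=> [||y y0 y1].
      * by rewrite (meetx0 L) t0 (td _ x0 x1).
      * by rewrite (meetx1 L) t1 (td _ x0 x1).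
      * by rewrite (mid y x) // (meetxx L) (td _ x0 x1).
  - elim/cases=> [y|y|x x0 x1].
    + by rewrite (join0x L) t0; case: (to_D3 y).
    + by rewrite (join1x L) t1; case: (to_D3 y).
    + elim/cases=> [||y y0 y1].
      * by rewrite (joinx0 L) t0 (td _ x0 x1).
      * by rewrite (joinx1 L) t1 (td _ x0 x1).
      * have xx : x `|` x = x by apply/(le_joinP L)/(le_refl L).
        by rewrite (mid y x) // xx (td _ x0 x1).
  - elim/cases=> [||x x0 x1].
    + by rewrite k0 t1 t0.
    + by rewrite k1 t1 t0.
    + by rewrite kmid // td.
  - elim/cases=> [||x x0 x1].
    + by rewrite (bneg0 Z) t1 t0.
    + by rewrite (bneg1 Z) t1 t0.
    + by rewrite (AOL_bneg P aol x0) t0 td.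
apply: (variety_S vV hf); last exact: VD.
elim/cases=> [||x x0 x1]; elim/cases=> [||y y0 y1]; rewrite ?t0 ?t1 ?td //.
by move=> _; exact: mid.
Qed.

Lemma monolithic_nontrivial (A : algebra) :
  bounded_lattice A -> monolithic A -> (0 : A) <> 1.
Proof.
move=> L [a [b [ab _]]] e; apply: ab.
by rewrite -(meetx1 L a) -(meetx1 L b) -e !(meetx0 L).
Qed.

(** * Joins of subvarieties *)

Lemma subclass_generated (K V : class) :
  variety V -> subclass K V -> subclass (generated_variety K) V.
Proof. by move=> vV KV A; apply. Qed.

(** [U] is itself an upper bound of [V] and [W]. Conversely, any upper bound contains the monolithic
    members of [U], hence all of [U]. *)
Lemma class_eq_join (U V W : class) : subvariety U ->
  subclass V U -> subclass W U ->
  (forall A, monolithic A -> U A -> V A \/ W A) ->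
  class_eq U (subvariety_join V W).
Proof.
move=> sU VU WU mU A; split=> [UA S sS VWS|]; last first.
  by apply=> // B [/VU|/WU].
apply: (subclass_monolithic sU.1 sS.1 _ UA) => B mB UB.
by apply: VWS; exact: mU.
Qed.

Lemma V1_monolithic (A : algebra) : monolithic A -> V1 A -> OML A \/ AOL A.
Proof. by move=> mA [P j2 wsdm]; exact: monolithic_OML_AOL. Qed.

Lemma V2_V1 : subclass V2 V1.
Proof. by move=> A [P j2 /SDM_WSDM]. Qed.

Lemma OML_V2 : subclass OML V2.
Proof. by move=> A o; have P := o.1; split=> //; [exact: OML_J2|exact: OML_SDM]. Qed.

Lemma AOL_V1 : subclass AOL V1.
Proof. by move=> A o; have P := o.1; split=> //; [exact: AOL_J2|exact: AOL_WSDM]. Qed.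

Theorem theorem63 :
  class_eq V1 (subvariety_join OML (generated_variety AOL)) /\
  class_eq V2 (subvariety_join OML SAOL) /\
  class_eq V3 (subvariety_join OML (generated_variety (singleton_class D3))).
Proof.
(* This inclusion of V(AOL) in [V1] also supplies J2 for [SAOL] in the second equality. *)
have AOL_gen := subclass_generated subvariety_V1.1 AOL_V1.
split; [|split]; apply: class_eq_join.
- exact: subvariety_V1.
- by move=> A /OML_V2/V2_V1.
- exact: AOL_gen.
- by move=> A mA /(V1_monolithic mA)[]; [left|right; exact: sub_generated].
- exact: subvariety_V2.
- exact: OML_V2.
- by move=> A [/AOL_gen[P j2 _] sdm].
- move=> A mA V2A; have [_ _ sdm] := V2A.
  have [|aol] := V1_monolithic mA (V2_V1 V2A); first by left.
  by right; split=> //; exact: sub_generated.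
- exact: subvariety_V3.
- move=> A o; have P := o.1; have [_ j2 wsdm] := V2_V1 (OML_V2 o).
  by split=> //; exact: OML_SK.
- by apply: subclass_generated subvariety_V3.1 _ => A ->; exact: V3_D3.
- move=> A mA [P j2 wsdm sk].
  have [|aol] := V1_monolithic mA (And3 P j2 wsdm); first by left.
  right; apply: AOL_SK_generated => //; apply: monolithic_nontrivial mA.
  exact: bi_lattice (pk_involution (bz_pseudo_kleene (pbz_bz P))).
Qed.
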